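(* Let $K$ and $K'$ be subspaces of (the underlying projective space $P^n(\mathbb{R})$ of) a Cayley-Klein space of dimension $n$ such that $K\subseteq K'$. Then: 1. Every total polar of $K$ contains a total polar of $K'$. 2. Every total polar of $K'$ can be extended to a total polar of $K$, i.e. it is contained in some total polar of $K$.
   Context: Conventions. Subspaces are projective subspaces, including $\varnothing$ (of dimension $-1$) and the whole space; $\dim$ is projective dimension; $S+T$ is the smallest subspace containing $S$ and $T$; a point $X$ is identified with $\{X\}$. A hyperplane of a subspace $S$ is a subspace of $S$ of dimension $\dim S-1$. A set of points is independent if representing vectors are linearly independent; a set of hyperplanes is independent if the linear forms defining them are linearly independent. The intersection of the empty family of hyperplanes is the whole space. Quadrics. A quadric $Q$ in a real projective space $P(V)$ is the set $\{[x] : f(x,x)=0\}$ for a symmetric bilinear form $f$ on $V$ that is not identically zero; it is considered together with $f$. Points $[x],[y]$ are conjugate with respect to $Q$ if $f(x,y)=0$. The polar of a subspace $K$ with respect to $Q$ is the set of all points of $P(V)$ conjugate to every point of $K$. The vertex of $Q$ is the polar of $P(V)$; $Q$ is non-degenerate if its vertex is empty. Cayley-Klein space. Put $A_0=P^n(\mathbb{R})$. A Cayley-Klein space of dimension $n$ is $P^n(\mathbb{R})$ with a sequence $Q_0,A_1,Q_1,A_2,\dots,A_r,Q_r,A_{r+1}=\varnothing$ such that, for $0\le i\le r$, $Q_i$ is a quadric in $A_i$ with vertex $A_{i+1}$. Its absolute figure is the sequence of complex extensions $\hat Q_0\supseteq\hat A_1\supseteq\hat Q_1\supseteq\cdots\supseteq\hat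 A_r\supseteq\hat Q_r\supseteq\hat A_{r+1}=\varnothing$. Total polars. If $X$ is a point with $X\in A_l\setminus A_{l+1}$, a total polar of $X$ is a hyperplane of $P^n(\mathbb{R})$ containing $X^{p_l}$ (the polar of $X$ in $A_l$ with respect to $Q_l$). If $K$ is a $k$-dimensional subspace, a total polar of $K$ is an $(n-k-1)$-dimensional subspace of the form $\bigcap_{i=0}^k H_i$, where $\{X_0,\dots,X_k\}$ is some independent subset $B$ of $K$ with $|B\cap A_j|=\dim(K\cap A_j)+1$ for $0\le j\le r$, each $H_i$ is a total polar of $X_i$, and $\{H_0,\dots,H_k\}$ is independent. ($P^n(\mathbb{R})$ and $\varnothing$ are total polar to each other.) *)

(* Defs.v *)
From mathcomp Require Import all_boot all_order all_algebra.
From mathcomp Require Import classical_sets reals.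

Set Implicit Arguments.
Unset Strict Implicit.
Unset Printing Implicit Defensive.

Import GRing.Theory.
Local Open Scope ring_scope.

(* A projective subspace S of P^n(R) is given by the corresponding linear
   subspace of the row vectors of length n.+1, so that dim S = \dim S - 1 and
   the empty subspace is 0%VS.  Sets of points that are not yet known to be
   subspaces (polars) are given by the sets of their representing vectors,
   together with the zero vector. *)
Definition subspace (R : realType) (n : nat) : Type := {vspace 'rV[R]_n.+1}.

Definition is_point (R : realType) (n : nat) (X : subspace R n) : bool :=
  \dim X == 1%N.

Definition is_hyperplane (R : realType) (n : nat) (H : subspace R n) : bool :=
  \dim H == n.

Definition indep_points (R : realType) (n : nat) (Xs : seq (subspace R n)) :
    Prop :=
  exists2 xs : seq 'rV[R]_n.+1, free xs & Xs = [seq <[x]>%VS | x <- xs].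

Definition indep_hyperplanes (R : realType) (n : nat)
    (Hs : seq (subspace R n)) : Prop :=
  exists2 phis : seq 'Hom('rV[R]_n.+1, R^o),
    free phis & Hs = [seq lker phi | phi <- phis].

(* The point set of the quadric is {[x] | qform x x = 0}; over the reals it does
   not determine the form, which is therefore the primitive datum. *)
Record quadric (R : realType) (n : nat) (A : subspace R n) := Quadric {
  qform : {symmetric (subvs_of A)};
  qform_neq0 : exists x y : subvs_of A, qform x y != 0
}.

(* For Q a quadric in A and K a subspace of A. *)
Definition polar (R : realType) (n : nat) (A : subspace R n) (Q : quadric A)
    (K : subspace R n) : set 'rV[R]_n.+1 :=
  [set vsval y | y in
    [set y : subvs_of A | forall x : subvs_of A,
                            vsval x \in K -> qform Q x y = 0]]%classic.

Definition vertex (R : realType) (n : nat) (A : subspace R n) (Q : quadric A) :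
    set 'rV[R]_n.+1 :=
  polar Q A.

(* Only the values ck_space 0, ..., ck_space ck_rank.+1 are meaningful. *)
Record cayley_klein (R : realType) (n : nat) := CayleyKlein {
  ck_rank : nat;
  ck_space : nat -> subspace R n;
  ck_quadric : forall i : 'I_ck_rank.+1, quadric (ck_space i);
  ck_space_first : ck_space 0%N = fullv;
  ck_space_last : ck_space ck_rank.+1 = 0%VS;
  ck_vertex : forall i : 'I_ck_rank.+1,
    vertex (ck_quadric i) = [set` ck_space i.+1]%classic
}.

Arguments ck_quadric {R n} c i.

Definition point_total_polar (R : realType) (n : nat) (C : cayley_klein R n)
    (X H : subspace R n) : Prop :=
  [/\ is_point X, is_hyperplane H &
      exists l : 'I_(ck_rank C).+1,
        [/\ (X <= ck_space C l)%VS, ~~ (X <= ck_space C l.+1)%VS &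
            (polar (ck_quadric C l) X `<=` [set` H])%classic]].

(* Since \dim K = k + 1, the points X_0, ..., X_k and the hyperplanes
   H_0, ..., H_k are indexed by 'I_(\dim K), and a subspace of projective
   dimension n - k - 1 has linear dimension n + 1 - \dim K. *)
Definition total_polar (R : realType) (n : nat) (C : cayley_klein R n)
    (K P : subspace R n) : Prop :=
  \dim P = (n.+1 - \dim K)%N /\
  exists Xs Hs : (\dim K).-tuple (subspace R n),
    [/\ indep_points Xs,
        (forall i, (tnth Xs i <= K)%VS),
        (forall j, (j <= ck_rank C)%N ->
           count (fun X => (X <= ck_space C j)%VS) Xs
             = \dim (K :&: ck_space C j)%VS),
        (forall i, point_total_polar C (tnth Xs i) (tnth Hs i)) &
        indep_hyperplanes Hs /\ P = (\bigcap_(i < \dim K) tnth Hs i)%VS].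

(* Main.v *)
Require Import Defs.
From HB Require Import structures.
From mathcomp Require Import all_boot all_order all_algebra.
From mathcomp Require Import classical_sets reals zify.

(* Dually, a subspace P is given by the space W of linear forms vanishing on it.
   Write k for dim K (linear dimensions throughout), f_l for the form of Q_l, and
   let E_l(K) be the space of the forms that coincide on A_l with f_l(x, -) for
   some x in the intersection of K and A_l.  These spaces increase with l, and W
   comes from a total polar of K if and only if dim W = k and, for every l,
     dim (W /\ E_l(K)) >= k - dim (K /\ A_(l+1)).
   For K inside K' we have dim E_l(K') >= k' - dim (K' /\ A_(l+1)), so that W can
   be enlarged one vector at a time to satisfy the conditions for K'.  Conversely,
   the codimension of E_l(K) in E_l(K') is small enough for the conditions for K'
   to imply the inequalities for K, and W can be cut down along the flag E_l(K). *)

Set Implicit Arguments.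
Unset Strict Implicit.
Unset Printing Implicit Defensive.

Import GRing.Theory.
Local Open Scope ring_scope.

(** * Subspaces with prescribed intersections along a flag *)

Section FlagExtension.
Variables (F : fieldType) (L : vectType F) (r : nat).
Implicit Types (U V W : {vspace L}).

Lemma dim_addv_line U v : v \notin U -> \dim (U + <[v]>) = (\dim U).+1.
Proof.
move=> U'v; have : free (v :: vbasis U).
  by rewrite free_cons (span_basis (vbasisP U)) U'v (basis_free (vbasisP U)).
by move/eqP; rewrite span_cons (span_basis (vbasisP U)) /= size_tuple addvC.
Qed.

Lemma subv_between U V m : (U <= V)%VS -> (\dim U <= m <= \dim V)%N ->
  exists W, [/\ (U <= W)%VS, (W <= V)%VS & \dim W = m].
Proof.
move=> sUV /andP[leUm]; rewrite -(subnKC leUm).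
elim: (m - _)%N => [_|c IHc ltV]; first by exists U; rewrite subvv addn0.
have [|W [sUW sWV dimW]] := IHc; first lia.
have /subvPn[v Vv W'v] : ~~ (V <= W)%VS.
  by apply/negP => /dimvS; rewrite dimW; lia.
exists (W + <[v]>)%VS; split; first exact: subv_trans sUW (addvSl _ _).
  by rewrite subv_add sWV -memvE.
by rewrite dim_addv_line ?dimW ?addnS.
Qed.

(** Each condition may fall short by at most [c], the number of vectors still to be added. One
    well-chosen vector lowers every shortfall of full size, and induction on [c] finishes. *)
Lemma flag_extension (E : nat -> {vspace L}) (m : nat -> nat) c W :
    (forall i j, (i <= j <= r)%N -> (E i <= E j)%VS) ->
    (forall l, (l <= r)%N -> (m l <= \dim (E l))%N) ->
    (forall l, (l <= r)%N -> (m l <= \dim (W :&: E l) + c)%N) ->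
    m r = (\dim W + c)%N ->
  exists W', [/\ (W <= W')%VS, \dim W' = (\dim W + c)%N &
    forall l, (l <= r)%N -> (m l <= \dim (W' :&: E l))%N].
Proof.
move=> E_mono leE; elim: c W => [|c IHc] W leW def_mr.
  exists W; rewrite subvv addn0; split=> // l le_lr.
  by have := leW l le_lr; rewrite addn0.
(* The new vector is taken in the first E l0 whose condition fails by the full
   amount c.+1; it then also serves all the larger E l. *)
pose deficient l := (l <= r)%N && (\dim (W :&: E l) + c < m l)%N.
(* The last index is always deficient: [m r] exceeds [\dim W] by [c.+1]. *)
have exd : exists l, deficient l.
  by exists r; rewrite /deficient leqnn /=; have := dimvS (capvSl W (E r)); lia.
case: (ex_minnP exd) => l0 /andP[le_l0r lt_l0] min_l0.
have /subvPn[v E0v WE'v] : ~~ (E l0 <= W :&: E l0)%VS.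
  by apply/negP => /dimvS; have := leE _ le_l0r; lia.
have W'v : v \notin W by rewrite memv_cap E0v andbT in WE'v.
have dimWv U : (U <= W)%VS -> (\dim (U + <[v]>) = (\dim U).+1)%N.
  by move=> sUW; rewrite dim_addv_line //; apply: contra W'v; apply: subvP.
have [l le_lr||W2 [sW2 dimW2 leW2]] := IHc (W + <[v]>)%VS.
- have [le_l0l|lt_ll0] := leqP l0 l.
    have sWE : (W :&: E l + <[v]> <= (W + <[v]>) :&: E l)%VS.
      rewrite subv_cap addvS ?capvSl //= subv_add capvSr -memvE.
      by rewrite (subvP (E_mono l0 l _)) ?le_l0l.
    have := dimvS sWE; rewrite dimWv ?capvSl //; have := leW _ le_lr; lia.
  have : ~~ deficient l by apply: contraL lt_ll0 => /min_l0; rewrite leqNgt.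
  rewrite /deficient le_lr /= -leqNgt => /leq_trans-> //.
  by rewrite leq_add2r dimvS ?capvS ?addvSl.
- by rewrite dimWv //; lia.
exists W2; split=> //; first exact: subv_trans (addvSl _ _) sW2.
by rewrite dimW2 dimWv //; lia.
Qed.

(** [W'] is grown from zero along the flag [W :&: E l]; as its dimension is [m r], the condition at
    [r] forces it into [W]. *)
Lemma flag_restriction (E : nat -> {vspace L}) (m : nat -> nat) W :
    (forall i j, (i <= j <= r)%N -> (E i <= E j)%VS) ->
    (forall l, (l <= r)%N -> (m l <= m r)%N) ->
    (forall l, (l <= r)%N -> (m l <= \dim (W :&: E l))%N) ->
  exists W', [/\ (W' <= W)%VS, \dim W' = m r &
    forall l, (l <= r)%N -> (m l <= \dim (W' :&: E l))%N].
Proof.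
move=> E_mono m_mono leW.
have [||||W' [_]] := @flag_extension (fun l => W :&: E l)%VS m (m r) 0%VS.
- by move=> i j le_ijr; rewrite capvS ?E_mono.
- exact: leW.
- by move=> l le_lr; rewrite cap0v dimv0 m_mono.
- by rewrite dimv0.
rewrite dimv0 add0n => dimW' leW'; exists W'; split=> // [|l le_lr].
  have /eqP <- : (W' :&: (W :&: E r) == W')%VS.
    by rewrite eqEdim capvSl dimW' leW'.
  exact: subv_trans (capvSr _ _) (capvSl _ _).
by apply: leq_trans (leW' l le_lr) (dimvS _); rewrite capvS ?capvSr.
Qed.

End FlagExtension.

(** * Annihilators and common kernels of linear forms *)

Section Annihilator.
Variables (F : fieldType) (V : vectType F).
Implicit Types (U : {vspace V}) (phi : 'Hom(V, F^o)).

(** Vanishing on [U] is encoded as a zero composite with the projection onto [U], which makes the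
    annihilator the kernel of a linear map. *)
Definition annihilator U : {vspace 'Hom(V, F^o)} :=
  lker (linfun (fun phi => (phi \o projv U)%VF)).

Lemma annihilatorP U phi :
  reflect (forall v, v \in U -> phi v = 0) (phi \in annihilator U).
Proof.
(* [linfun] agrees with its argument only if that is linear, hence the packed version [ff]. *)
pose f := fun phi : 'Hom(V, F^o) => (phi \o projv U)%VF.
have fL : linear f by move=> a u w; rewrite /f comp_lfunDl comp_lfunZl.
pose flM := GRing.isLinear.Build _ _ _ _ f fL.
pose ff : {linear _ -> _} := HB.pack f flM.
rewrite memv_ker (lfunE ff) /= /f; apply: (iffP eqP) => [phi0 v Uv|phi0].
  by have /lfunP/(_ v) := phi0; rewrite comp_lfunE projv_id // zero_lfunE.
by apply/lfunP => v; rewrite comp_lfunE zero_lfunE phi0 ?memv_proj.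
Qed.

(** A form vanishing on [U] is determined by its restriction to [U^C]. *)
Lemma dim_annihilator U : (\dim (annihilator U) + \dim U <= dim V)%N.
Proof.
pose f := fun phi : 'Hom(V, F^o) =>
  (phi \o linfun (vsval : subvs_of U^C%VS -> V))%VF.
have fL : linear f by move=> a u w; rewrite /f comp_lfunDl comp_lfunZl.
pose flM := GRing.isLinear.Build _ _ _ _ f fL.
pose ff : {linear _ -> _} := HB.pack f flM.
have ker0 : (annihilator U :&: lker (linfun ff) = 0)%VS.
  apply/eqP; rewrite -subv0; apply/subvP => phi /memv_capP[/annihilatorP phi0].
  rewrite memv_ker lfunE memv0 => /eqP /lfunP phiC0; apply/eqP/lfunP => v.
  rewrite zero_lfunE -(subrK (projv U v) v) linearD /=.
  rewrite (phi0 (projv _ _)) ?memv_proj // addr0.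
  have := phiC0 (vsproj U^C%VS (v - projv U v)).
  by rewrite /= /f comp_lfunE lfunE /= vsprojK ?memv_projC // zero_lfunE.
rewrite -(limg_dim_eq ker0).
have /dimvS := subvf (linfun ff @: annihilator U)%VS.
rewrite dimvf.
have -> : dim 'Hom(subvs_of U^C%VS, F^o) = \dim U^C%VS.
  by rewrite /dim /= muln1.
rewrite dimv_compl dimvf; have := dimvS (subvf U); rewrite dimvf => leU.
by rewrite leq_subRL // addnC.
Qed.

Lemma dim_cap_ker U phi : (\dim U <= (\dim (U :&: lker phi)).+1)%N.
Proof.
rewrite -(limg_ker_dim phi U) -addn1 leq_add2l.
by have /dimvS := subvf (phi @: U)%VS; rewrite dimvf.
Qed.

(** The forms annihilate their common kernel, which bounds the sum from above; each further kernel
    costs at most one dimension, which bounds it from below. *)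
Lemma dim_bigcap_ker (phis : seq 'Hom(V, F^o)) : free phis ->
  (\dim (\bigcap_(phi <- phis) lker phi) + size phis = dim V)%N.
Proof.
move=> free_phis; set P := (\bigcap_(_ <- _) _)%VS.
have sub : (<<phis>> <= annihilator P)%VS.
  apply/span_subvP => phi phis_phi; apply/annihilatorP => v.
  by rewrite /P (big_rem phi) //= memv_cap memv_ker => /andP[/eqP].
have := leq_trans (leq_add (dimvS sub) (leqnn _)) (dim_annihilator P).
rewrite (eqP free_phis) addnC => le; apply/eqP; rewrite eqn_leq le /=.
rewrite {sub le}/P; elim: (phis) => [|phi s IHs] /=.
  by rewrite big_nil addn0 dimvf.
rewrite big_cons capvC.
have := dim_cap_ker (\bigcap_(j <- s) lker j)%VS phi; lia.
Qed.

(** Stated with the span, so that an inclusion of spans gives the reverse inclusion of common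
    kernels. *)
Lemma memv_bigcap_ker (phis : seq 'Hom(V, F^o)) v :
  reflect (forall phi, phi \in <<phis>>%VS -> phi v = 0)
          (v \in \bigcap_(phi <- phis) lker phi)%VS.
Proof.
apply: (iffP idP) => [Pv phi|phi0].
  suff /subvP sub : (<<phis>> <= annihilator <[v]>)%VS.
    by move=> /sub/annihilatorP; apply; rewrite memv_line.
  apply/span_subvP => psi phis_psi; apply/annihilatorP => _ /vlineP[k ->].
  move: Pv; rewrite (big_rem psi) //= memv_cap memv_ker.
  move=> /andP[/eqP psi_v _].
  by rewrite linearZ /= psi_v scaler0.
elim: phis phi0 => [|phi s IHs] phi0; first by rewrite big_nil memvf.
rewrite big_cons memv_cap memv_ker phi0 ?memv_span ?mem_head //= eqxx.
apply: IHs => psi s_psi; apply: phi0; apply: subvP s_psi.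
by apply/sub_span => x; rewrite inE => ->; rewrite orbT.
Qed.

End Annihilator.

(** [K :&: A'] and [K' :&: A] lie in [K' :&: A'] and meet inside [K :&: A]. *)
Lemma dim_cap_sub (F : fieldType) (V : vectType F) (K K' A A' : {vspace V}) :
    (K <= K')%VS -> (A <= A')%VS ->
  (\dim (K :&: A') + \dim (K' :&: A) <= \dim (K' :&: A') + \dim (K :&: A))%N.
Proof.
move=> sKK' sAA'; rewrite -(dimv_sum_cap (K :&: A') (K' :&: A)) leq_add ?dimvS //.
  by rewrite subv_add !capvS.
rewrite subv_cap (subv_trans (capvSl _ _) (capvSl _ _)).
exact: subv_trans (capvSr _ _) (capvSr _ _).
Qed.

(** * Chains of symmetric forms, each space being the radical of the preceding form *)

Section RadicalChain.
Variables (F : fieldType) (V : vectType F) (r : nat).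
Variables (A : nat -> {vspace V}) (f : nat -> 'Hom(V, 'Hom(V, F^o))).
Hypotheses (A_first : A 0 = fullv) (A_last : A r.+1 = 0%VS).
Hypothesis A_step : forall l, (l <= r)%N -> (A l.+1 <= A l)%VS.
Hypothesis f_sym :
  forall l x y, (l <= r)%N -> x \in A l -> y \in A l -> f l x y = f l y x.
Hypothesis f_radical : forall l x, (l <= r)%N -> x \in A l ->
  reflect (forall y, y \in A l -> f l x y = 0) (x \in A l.+1).
Implicit Types (K : {vspace V}) (W : {vspace 'Hom(V, F^o)}).
Implicit Types (phi : 'Hom(V, F^o)) (ps : seq (V * 'Hom(V, F^o))).

Let B l := annihilator (A l).

(** This is E_l(K); the summand [B l] makes membership depend only on values on [A l]. *)
Definition polar_forms K l := (B l + f l @: (K :&: A l))%VS.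

(* The kernel of p.2 contains the polar of p.1 in A l; it may contain A l, as a
   total polar of a point may. *)
Definition form_of_polar l (p : V * 'Hom(V, F^o)) : Prop :=
  [/\ p.1 \in A l, p.1 \notin A l.+1 &
      forall y, y \in A l -> f l p.1 y = 0 -> p.2 y = 0].

(** A pair consists of a vector representing a point [X_i] and a form defining the hyperplane [H_i]
    in a total polar of [K]. *)
Definition adapted K ps : Prop :=
  [/\ free (unzip1 ps), (<<unzip1 ps>> = K)%VS,
      forall j, (j <= r)%N ->
        count (mem (A j)) (unzip1 ps) = \dim (K :&: A j) &
      forall p, p \in ps -> exists2 l, (l <= r)%N & form_of_polar l p].

Lemma chain_sub i j : (i <= j <= r.+1)%N -> (A j <= A i)%VS.
Proof.
case/andP=> /subnKC <-; elim: (j - i)%N => [|c IHc]; first by rewrite addn0.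
rewrite addnS ltnS => le; apply: subv_trans (A_step le) (IHc _); lia.
Qed.

Lemma polar_formsP K l phi :
  reflect (exists2 x, x \in (K :&: A l)%VS &
             forall y, y \in A l -> phi y = f l x y)
          (phi \in polar_forms K l).
Proof.
apply: (iffP memv_addP) => [[b /annihilatorP b0 [_ /memv_imgP[x Kx ->] ->]]|].
  by exists x => // y Ay; rewrite add_lfunE b0 ?add0r.
case=> x Kx phiE; exists (phi - f l x); last exists (f l x).
- by apply/annihilatorP => y Ay; rewrite add_lfunE opp_lfunE phiE ?subrr.
- exact: memv_img.
- by rewrite subrK.
Qed.

Lemma polar_forms_sub K l : (l <= r)%N -> (polar_forms K l <= B l.+1)%VS.
Proof.
move=> le_lr; apply/subvP => phi /polar_formsP[x /memv_capP[_ Ax] phiE].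
apply/annihilatorP => y Ay'; have Ay := subvP (A_step le_lr) _ Ay'.
rewrite phiE // f_sym //; have /f_radical := Ay'; exact.
Qed.

(** For [i < j], the forms of level [i] vanish on the radical [A i.+1], hence on [A j], and so
    already belong to [B j]. *)
Lemma polar_forms_mono K i j :
  (i <= j <= r)%N -> (polar_forms K i <= polar_forms K j)%VS.
Proof.
case/andP; rewrite leq_eqVlt => /predU1P[-> //|lt_ij le_jr].
have le_ir : (i <= r)%N by lia.
apply: subv_trans (polar_forms_sub K le_ir) _.
apply: subv_trans (addvSl _ _); apply/subvP => phi /annihilatorP phi0.
apply/annihilatorP => y Ay; apply: phi0; apply: subvP Ay.
by apply: chain_sub; lia.
Qed.

Lemma polar_formsS K K' l :
  (K <= K')%VS -> (polar_forms K l <= polar_forms K' l)%VS.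
Proof. by move=> sKK'; rewrite addvS // limgS // capvS. Qed.

Lemma form_annihilator l x : (l <= r)%N -> x \in A l ->
  (f l x \in B l) = (x \in A l.+1).
Proof. by move=> le_lr Ax; exact: sameP (annihilatorP _ _) (f_radical le_lr Ax). Qed.

(** Modulo [B l], the map [f l] on [K :&: A l] has kernel [K :&: A l.+1], so it is injective on the
    complement [Y]. *)
Lemma dim_polar_forms K l : (l <= r)%N ->
  (\dim (polar_forms K l) + \dim (K :&: A l.+1) =
   \dim (B l) + \dim (K :&: A l))%N.
Proof.
move=> le_lr; pose Y := ((K :&: A l) :\: A l.+1)%VS.
have sYA : (Y <= A l)%VS by rewrite (subv_trans (diffvSl _ _)) ?capvSr.
have Y0 y : y \in Y -> f l y \in B l -> y = 0.
  move=> Yy; rewrite form_annihilator ?(subvP sYA) // => Ay.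
  by apply/eqP; rewrite -memv0 -(capv_diff (K :&: A l) (A l.+1)) memv_cap Yy.
have defE : polar_forms K l = (B l + f l @: Y)%VS.
  rewrite /polar_forms -{1}(addv_diff_cap (K :&: A l) (A l.+1)) limgD addvA.
  apply/addv_idPl; apply: subv_trans (addvSl _ _).
  apply/subvP => _ /memv_imgP[x /memv_capP[/memv_capP[_ Ax] A'x] ->].
  by rewrite form_annihilator.
rewrite defE dimv_disjoint_sum.
  rewrite limg_dim_eq.
    rewrite -addnA; congr addn; rewrite -(dimv_cap_compl (K :&: A l) (A l.+1)).
    by rewrite -capvA (capv_idPr (A_step le_lr)) addnC.
  apply/eqP; rewrite -subv0; apply/subvP => y /memv_capP[Yy].
  rewrite memv_ker memv0 => /eqP fy0; apply/eqP/Y0 => //.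
  by rewrite fy0 mem0v.
apply/eqP; rewrite -subv0; apply/subvP => phi /memv_capP[Bphi /memv_imgP[y Yy def_y]].
by rewrite def_y (Y0 y) ?linear0 ?mem0v // -def_y.
Qed.

(** The right-hand side does not decrease with [l], because [B l.+1] contains [polar_forms K l]. *)
Lemma dim_annihilator_ge K l : (l <= r.+1)%N ->
  (\dim K <= \dim (B l) + \dim (K :&: A l))%N.
Proof.
elim: l => [_|l IHl lt_lr]; first by rewrite A_first capvf leq_addl.
apply: leq_trans (IHl _) _; first lia.
by rewrite -dim_polar_forms // leq_add2r dimvS ?polar_forms_sub.
Qed.

(** On [A l], a form that vanishes on the kernel of the nonzero form [f l p.1] is a multiple of
    it. *)
Lemma form_of_polar_polar_forms K l p : (l <= r)%N -> p.1 \in K ->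
  form_of_polar l p -> p.2 \in polar_forms K l.
Proof.
case: p => x phi le_lr /= Kx [/= Ax A'x phi0].
have /subvPn[y Ay fxy] : ~~ (A l <= lker (f l x))%VS.
  apply: contra A'x => /subvP fx0; apply/f_radical => // y /fx0.
  by rewrite memv_ker => /eqP.
rewrite memv_ker in fxy; apply/polar_formsP.
exists (phi y / f l x y *: x) => [|z Az]; first by rewrite memvZ // memv_cap Kx.
have : phi (z - f l x z / f l x y *: y) = 0.
  apply: phi0; first by rewrite memvB ?memvZ.
  by rewrite linearB linearZ /= -[_ *: _]/(_ * _) divfK ?subrr.
rewrite linearB linearZ /= -[_ *: _]/(_ * _) => /eqP; rewrite subr_eq0 => /eqP->.
by rewrite linearZ scale_lfunE /= -[RHS]/(_ * _) mulrAC [RHS]mulrAC (mulrC (phi y)).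
Qed.

(** * Necessity of the dimension inequalities *)

Lemma adapted_count K ps j : adapted K ps -> (j <= r.+1)%N ->
  count (mem (A j)) (unzip1 ps) = \dim (K :&: A j).
Proof.
case=> free_xs _ cnt _; rewrite leq_eqVlt => /predU1P[->|]; last exact: cnt.
rewrite A_last capv0 dimv0; apply/eqP; rewrite -leqn0 leqNgt -has_count.
apply/hasPn => x /(free_not0 free_xs); by rewrite inE memv0.
Qed.

(** Exactly [\dim K - \dim (K :&: A l.+1)] of the points lie outside [A l.+1]; their levels are at
    most [l], so their independent forms lie in [polar_forms K l]. *)
Lemma adapted_dim_cap K ps l : adapted K ps -> free (unzip2 ps) -> (l <= r)%N ->
  (\dim K <= \dim (<<unzip2 ps>> :&: polar_forms K l) + \dim (K :&: A l.+1))%N.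
Proof.
move=> ad free_phis le_lr; have [free_xs spanK _ polar_ps] := ad.
pose q := [seq p <- ps | p.1 \notin A l.+1].
have free_q : free (unzip2 q).
  apply: (@catl_free _ _ (unzip2 [seq p <- ps | predC [pred p | p.1 \notin A l.+1] p])).
  rewrite -map_cat (@perm_free _ _ _ (unzip2 ps)) // perm_map //.
  by rewrite (permPl (permEl (perm_filterC _ _))).
have -> : \dim K = (size (unzip2 q) + \dim (K :&: A l.+1))%N.
  rewrite -(adapted_count ad) // -spanK (eqP free_xs) !size_map size_filter.
  rewrite count_map -(count_predC (fun p => p.1 \notin A l.+1)).
  by congr addn; apply: eq_count => p /=; rewrite negbK.
rewrite leq_add2r -(eqP free_q) dimvS //; apply/span_subvP => phi.
case/mapP => p; rewrite mem_filter => /andP[A'p ps_p] ->; rewrite memv_cap.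
rewrite memv_span ?map_f //=; have [i le_ir polar_p] := polar_ps p ps_p.
have le_il : (i <= l)%N.
  rewrite leqNgt; apply: contra A'p => lt_li; have [Ap _ _] := polar_p.
  by apply: subvP Ap; apply: chain_sub; lia.
apply: (subvP (@polar_forms_mono K i l _)); first by rewrite le_il.
apply: form_of_polar_polar_forms => //.
by rewrite -spanK memv_span ?map_f.
Qed.

(** * Sufficiency of the dimension inequalities *)

(** One level of the construction: [Phi] is spanned by the forms already used, [U] by those to be
    used once level [l] is done. *)
Lemma level_pairs K (U Phi : {vspace 'Hom(V, F^o)}) l : (l <= r)%N ->
    (Phi <= U :&: B l)%VS -> (U <= polar_forms K l)%VS ->
    (\dim U + \dim (K :&: A l.+1) = \dim Phi + \dim (K :&: A l))%N ->
  exists ps,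
    [/\ (<<unzip1 ps>> + K :&: A l.+1 = K :&: A l)%VS,
        (Phi + <<unzip2 ps>> = U)%VS,
        (size ps + \dim (K :&: A l.+1) = \dim (K :&: A l))%N &
        forall p, p \in ps -> form_of_polar l p].
Proof.
move=> le_lr sPhi sU dimU; have sA := A_step le_lr.
(* T consists of the x for which f l x agrees on A l with a form of U, namely g x.
   The points of Y1, a complement of T modulo A l.+1, are paired arbitrarily with
   the forms of S1, which vanish on A l. *)
pose T := (K :&: A l :&: (f l @^-1: (U + B l)))%VS.
pose Y2 := (T :\: A l.+1)%VS; pose g := (addv_pi1 U (B l) \o f l)%VF.
have sTA : (T <= A l)%VS by rewrite (subv_trans (capvSl _ _)) ?capvSr.
have sYT : (Y2 <= T)%VS by exact: diffvSl.
have gU y : g y \in U by rewrite comp_lfunE memv_pi1.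
have gB y : y \in T -> f l y - g y \in B l.
  case/memv_capP => _; rewrite -memv_preim => /addv_pi1_pi2 def_fy.
  by rewrite comp_lfunE -{1}def_fy addrC addKr memv_pi2.
have Y0 y : y \in Y2 -> g y \in B l -> y = 0.
  move=> Yy Bgy; have Ty := subvP sYT _ Yy; apply/eqP.
  rewrite -memv0 -(capv_diff T (A l.+1)) memv_cap Yy.
  rewrite -form_annihilator ?(subvP sTA) //.
  by rewrite -(subrK (g y) (f l y)) memvD ?gB.
have kerg : (Y2 :&: lker g = 0)%VS.
  apply/eqP; rewrite -subv0; apply/subvP => y /memv_capP[Yy].
  by rewrite memv_ker memv0 => /eqP gy0; rewrite (Y0 y) ?gy0 ?mem0v.
have capg : ((g @: Y2) :&: (U :&: B l) = 0)%VS.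
  apply/eqP; rewrite -subv0; apply/subvP.
  move=> _ /memv_capP[/memv_imgP[y Yy ->] /memv_capP[_ Bgy]].
  by rewrite (Y0 y) ?linear0 ?mem0v.
have defU : (g @: Y2 + U :&: B l = U)%VS.
  apply/eqP; rewrite eqEsubv subv_add capvSl andbT; apply/andP; split.
    by apply/subvP => _ /memv_imgP[y _ ->].
  (* On [A l], [phi] equals some [f l x]. Splitting [x] into [y] in [Y2] and [z] in the radical
     leaves [phi - g y] zero on [A l]. *)
  apply/subvP => phi Uphi.
  have /polar_formsP[x KAx phiE] := subvP sU _ Uphi.
  have Bphi : phi - f l x \in B l.
    by apply/annihilatorP => y Ay; rewrite add_lfunE opp_lfunE phiE ?subrr.
  have Tx : x \in T.
    rewrite memv_cap KAx -memv_preim -(subrK phi (f l x)) addrC memv_add //.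
    by rewrite -opprB memvN.
  have := Tx; rewrite -{1}(addv_diff_cap T (A l.+1)).
  case/memv_addP => y Yy [z /memv_capP[Tz Az] def_x].
  apply/memv_addP; exists (g y); first exact: memv_img.
  exists (phi - g y); last by rewrite addrC subrK.
  rewrite memv_cap memvB //=.
  have -> : phi - g y = (phi - f l x) + f l z + (f l y - g y).
    by rewrite def_x linearD /= opprD !addrA !subrK.
  apply: memvD; last exact/gB/(subvP sYT).
  by rewrite memvD ?form_annihilator ?(subvP sTA).
pose S1 := ((U :&: B l) :\: Phi)%VS.
pose Y1 := ((K :&: A l) :\: (Y2 + K :&: A l.+1))%VS.
have sY2 : (Y2 <= K :&: A l)%VS by exact: subv_trans sYT (capvSl _ _).
have capY2 : (Y2 :&: (K :&: A l.+1) = 0)%VS.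
  apply/eqP; rewrite -subv0 -(capv_diff T (A l.+1)) capvS //; exact: capvSr.
have dimY1 : (\dim Y1 + \dim Y2 + \dim (K :&: A l.+1) = \dim (K :&: A l))%N.
  have sYK : (Y2 + K :&: A l.+1 <= K :&: A l)%VS by rewrite subv_add sY2 capvS.
  rewrite -addnA -(dimv_disjoint_sum capY2) addnC
    -(dimv_cap_compl (K :&: A l) (Y2 + K :&: A l.+1)).
  by rewrite (capv_idPr sYK).
(* Both equal [\dim U - \dim Phi - \dim Y2]. *)
have dimS1 : \dim S1 = \dim Y1.
  have := dimv_cap_compl (U :&: B l) Phi; rewrite (capv_idPr sPhi) -/S1.
  have := dimv_disjoint_sum capg; rewrite defU (limg_dim_eq kerg); lia.
have szS1 : size (vbasis S1) = size (vbasis Y1) by rewrite !size_tuple.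
exists ([seq (y, g y) | y <- vbasis Y2] ++ zip (vbasis Y1) (vbasis S1)).
have -> : unzip1 ([seq (y, g y) | y <- vbasis Y2] ++ zip (vbasis Y1) (vbasis S1)) =
          vbasis Y2 ++ vbasis Y1.
  by rewrite /unzip1 map_cat -map_comp map_id -/unzip1 unzip1_zip ?szS1.
have -> : unzip2 ([seq (y, g y) | y <- vbasis Y2] ++ zip (vbasis Y1) (vbasis S1)) =
          map g (vbasis Y2) ++ vbasis S1.
  by rewrite /unzip2 map_cat -map_comp -/unzip2 unzip2_zip ?szS1.
rewrite !span_cat -limg_span !(span_basis (vbasisP _)); split.
- rewrite (addvC Y2) -addvA addv_diff; apply/addv_idPl.
  by rewrite subv_add sY2 capvS.
- by rewrite addvC -addvA addv_diff (addv_idPl sPhi).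
- by rewrite size_cat size_map size1_zip ?szS1 // !size_tuple addnC -dimY1; lia.
move=> p; rewrite mem_cat => /orP[/mapP[y y_Y2 ->]|p_zip].
  have Yy := vbasis_mem y_Y2; have Ty := subvP sYT _ Yy.
  split=> /= [||z Az fyz0]; first exact: subvP sTA _ Ty.
    apply: contraL (basis_not0 (vbasisP Y2) y_Y2) => Ay.
    by rewrite negbK -memv0 -(capv_diff T (A l.+1)) memv_cap Yy.
  have /annihilatorP/(_ z Az) := gB y Ty.
  by rewrite add_lfunE opp_lfunE fyz0 sub0r => /eqP; rewrite oppr_eq0 => /eqP.
have p1Y1 : p.1 \in vbasis Y1.
  by have := map_f fst p_zip; rewrite -/unzip1 unzip1_zip ?szS1.
have p2S1 : p.2 \in vbasis S1.
  by have := map_f snd p_zip; rewrite -/unzip2 unzip2_zip ?szS1.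
have := subvP (diffvSl _ _) _ (vbasis_mem p1Y1); rewrite memv_cap => /andP[Kp Ap].
split=> // [|y Ay _]; last first.
  have /memv_capP[_ /annihilatorP] := subvP (diffvSl _ _) _ (vbasis_mem p2S1).
  exact.
apply: contraL (basis_not0 (vbasisP Y1) p1Y1) => A'p; rewrite negbK -memv0.
rewrite -(capv_diff (K :&: A l) (Y2 + K :&: A l.+1)) memv_cap vbasis_mem //=.
by apply: subvP (addvSr _ _) _ _; rewrite memv_cap Kp.
Qed.

(** The pairs are built level by level. Before level [j] the points complement [K :&: A j] in [K],
    and the forms lie in [W] and vanish on [A j]. *)
Lemma adapted_of_dim_cap K W : \dim W = \dim K ->
    (forall l, (l <= r)%N ->
      (\dim K <= \dim (W :&: polar_forms K l) + \dim (K :&: A l.+1))%N) ->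
  exists ps, [/\ adapted K ps, free (unzip2 ps) & <<unzip2 ps>>%VS = W].
Proof.
move=> dimW leW.
suff build j : (j <= r.+1)%N -> exists ps,
    [/\ (<<unzip1 ps>> + K :&: A j = K)%VS,
        (<<unzip2 ps>> <= W :&: B j)%VS /\ free (unzip2 ps),
        (size ps + \dim (K :&: A j) = \dim K)%N,
        forall i, (i <= j)%N ->
          (count (mem (A i)) (unzip1 ps) + \dim (K :&: A j) = \dim (K :&: A i))%N &
        forall p, p \in ps -> exists2 l, (l <= r)%N & form_of_polar l p].
  have [ps []] := build r.+1 (leqnn _).
  rewrite A_last capv0 addv0 dimv0 addn0 => spanK [sW free_phis] szK cnt polar_ps.
  exists ps; split=> //.
    split=> // [|j le_jr]; first by rewrite /free spanK size_map szK.
    by rewrite -cnt ?addn0 // ltnW.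
  apply/eqP; rewrite eqEdim (subv_trans sW (capvSl _ _)) /= dimW -szK.
  by rewrite (eqP free_phis) size_map.
elim: j => [_|j IHj lt_jr].
  exists [::]; rewrite /= !span_nil nil_free sub0v add0v A_first capvf; split=> //.
  by move=> i; rewrite leqn0 => /eqP ->; rewrite A_first capvf.
have le_jr : (j <= r)%N by [].
have [ps [spanK [sW free_phis] szK cnt polar_ps]] := IHj (ltnW lt_jr).
have dimphis : \dim <<unzip2 ps>> = size ps by rewrite (eqP free_phis) size_map.
have sK : (K :&: A j.+1 <= K :&: A j)%VS by rewrite capvS ?A_step.
(* The inequality at level [j] leaves room in [W :&: polar_forms K j] for as many forms as there
   will be points. *)
have [||U [sphiU sUW dimU]] :=
    @subv_between _ _ <<unzip2 ps>>%VS (W :&: polar_forms K j)%VS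
      (\dim K - \dim (K :&: A j.+1)).
- exact: subv_trans sW (capvS (subvv _) (addvSl _ _)).
- rewrite dimphis; have := leW j le_jr; have := dimvS sK.
  set a := \dim (W :&: _)%VS; lia.
have leK := dimvS (capvSl K (A j.+1)).
have [|||qs [spanKj spanU szq polar_qs]] :=
    @level_pairs K U <<unzip2 ps>>%VS j le_jr.
- by rewrite subv_cap sphiU (subv_trans sW) ?capvSr.
- exact: subv_trans sUW (capvSr _ _).
- by rewrite dimU dimphis; lia.
have cntq i : (i <= j)%N -> count (mem (A i)) (unzip1 qs) = size qs.
  move=> le_ij; rewrite -(size_map fst qs); apply/eqP; rewrite -all_count.
  apply/allP => _ /mapP[p /polar_qs[Ap _ _] ->]; apply: subvP Ap.
  by apply: chain_sub; rewrite le_ij ltnW.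
exists (ps ++ qs); rewrite /unzip1 /unzip2 !map_cat !span_cat.
rewrite -/(unzip1 ps) -/(unzip2 ps) -/(unzip1 qs) -/(unzip2 qs).
split.
- by rewrite -addvA spanKj.
- rewrite spanU; split.
    rewrite subv_cap (subv_trans sUW (capvSl _ _)).
    by rewrite (subv_trans (subv_trans sUW (capvSr _ _))) ?polar_forms_sub.
  by rewrite /free span_cat spanU dimU size_cat !size_map; apply/eqP; lia.
- by rewrite size_cat; lia.
- move=> i; rewrite leq_eqVlt count_cat => /predU1P[->|lt_ij].
    have -> : count (mem (A j.+1)) (unzip1 qs) = 0%N.
      apply/eqP; rewrite -leqn0 leqNgt -has_count -all_predC.
      by apply/allP => _ /mapP[p /polar_qs[_ Ap _] ->].
    (* By the invariant [cnt] at [j], no earlier point lies in [A j]. *)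
    have : (count (mem (A j.+1)) (unzip1 ps) <= count (mem (A j)) (unzip1 ps))%N.
      by apply: sub_count => x; apply/subvP/A_step.
    by have := cnt j (leqnn j); lia.
  by rewrite cntq //; have := cnt i lt_ij; lia.
move=> p; rewrite mem_cat => /orP[/polar_ps //|/polar_qs polar_p].
by exists j.
Qed.

(** * Passing between [K] and [K'] *)

(** Replacing [K] by [K'] raises each lower bound by at most [\dim K' - \dim K], the number of
    vectors to be added. *)
Lemma adapted_extend K K' ps : (K <= K')%VS -> adapted K ps -> free (unzip2 ps) ->
  exists ps', [/\ adapted K' ps', free (unzip2 ps') &
                  (<<unzip2 ps>> <= <<unzip2 ps'>>)%VS].
Proof.
move=> sKK' ad free_phis; pose W := <<unzip2 ps>>%VS.
have dimW : \dim W = \dim K.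
  by have [/eqP free_xs <- _ _] := ad; rewrite free_xs (eqP free_phis) !size_map.
have leKK' := dimvS sKK'.
have [||||W' [sWW' dimW' leW']] := @flag_extension _ _ r (polar_forms K')
    (fun l => \dim K' - \dim (K' :&: A l.+1))%N (\dim K' - \dim K)%N W.
- exact: polar_forms_mono.
- move=> l le_lr; rewrite leq_subLR addnC dim_polar_forms //.
  exact/dim_annihilator_ge/leqW.
- move=> l le_lr; have := adapted_dim_cap ad free_phis le_lr.
  have := dimvS (capvS (subvv W) (polar_formsS l sKK')).
  have := dimvS (capvS sKK' (subvv (A l.+1))); rewrite -/W.
  set a := \dim (W :&: polar_forms K l)%VS; set b := \dim (W :&: _)%VS; lia.
- by rewrite A_last capv0 dimv0 subn0 dimW subnKC.
have [|l le_lr|ps' [ad' free' spanW']] := @adapted_of_dim_cap K' W'.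
- by rewrite dimW' dimW subnKC.
- by rewrite addnC -leq_subLR leW'.
by exists ps'; rewrite spanW'.
Qed.

Lemma adapted_restrict K K' ps' : (K <= K')%VS -> adapted K' ps' ->
    free (unzip2 ps') ->
  exists ps, [/\ adapted K ps, free (unzip2 ps) &
                 (<<unzip2 ps>> <= <<unzip2 ps'>>)%VS].
Proof.
move=> sKK' ad free_phis; pose W' := <<unzip2 ps'>>%VS.
(* Cutting [X] down to [polar_forms K l] costs at most the codimension of [polar_forms K l] in
   [polar_forms K' l]; [dim_polar_forms] expresses it by intersections with [A l] and [A l.+1], and
   [dim_cap_sub] bounds the former. *)
have leKl l : (l <= r)%N ->
    (\dim K <= \dim (W' :&: polar_forms K l) + \dim (K :&: A l.+1))%N.
  move=> le_lr; have sE := polar_formsS l sKK'.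
  pose X := (W' :&: polar_forms K' l)%VS.
  have := adapted_dim_cap ad free_phis le_lr; rewrite -/W' -/X.
  have := dimv_sum_cap X (polar_forms K l).
  rewrite -capvA (capv_idPr sE).
  have : (\dim (X + polar_forms K l) <= \dim (polar_forms K' l))%N.
    by rewrite dimvS // subv_add capvSr.
  have := dim_polar_forms K le_lr; have := dim_polar_forms K' le_lr.
  have := @dim_cap_sub _ _ K K' (A l) {:V}%VS sKK' (subvf _).
  rewrite !capvf; move: (\dim (X + _)) (\dim X) (\dim (W' :&: _)).
  move: (\dim (B l)) (\dim (polar_forms K l)) (\dim (polar_forms K' l)); lia.
have [||l le_lr|W [sWW' dimW leW]] := @flag_restriction _ _ r (polar_forms K)
    (fun l => \dim K - \dim (K :&: A l.+1))%N W'.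
- exact: polar_forms_mono.
- by move=> l le_lr; rewrite A_last capv0 dimv0 subn0 leq_subr.
- by rewrite leq_subLR addnC leKl.
(* As [A r.+1] is zero, the bound at [r] is [\dim K] itself. *)
rewrite A_last capv0 dimv0 subn0 in dimW.
have [//|l le_lr|ps [ad' free' spanW]] := @adapted_of_dim_cap K W.
  by rewrite addnC -leq_subLR leW.
by exists ps; rewrite spanW.
Qed.

End RadicalChain.

(** * Translation of total polars into vectors and forms *)

Section CayleyKlein.
Variables (R : realType) (n : nat).
Local Notation V := 'rV[R]_n.+1.
Implicit Types (C : cayley_klein R n) (K P : subspace R n).

(** The form of [Q] is extended from [A] to [V] by projection onto [A]. *)
Definition form_lfun (A : subspace R n) (Q : quadric A) : 'Hom(V, 'Hom(V, R^o)) :=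
  linfun (fun x => linfun (fun y => qform Q (vsproj A x) (vsproj A y) : R^o)).

Lemma form_lfunE (A : subspace R n) (Q : quadric A) x y :
  form_lfun Q x y = qform Q (vsproj A x) (vsproj A y).
Proof.
pose g1 x := fun y => qform Q (vsproj A x) (vsproj A y) : R^o.
have g1L z : linear (g1 z) by move=> a u w; rewrite /g1 !linearP.
pose g1F z : {linear V -> R^o} :=
  HB.pack (g1 z) (GRing.isLinear.Build _ _ _ _ (g1 z) (g1L z)).
pose g2 z := linfun (g1 z).
have g2E z w : g2 z w = g1 z w by exact: (lfunE (g1F z)).
have g2L : linear g2.
  move=> a u w; apply/lfunP => z.
  by rewrite add_lfunE scale_lfunE !g2E /g1 linearP linearPl.
pose g2F : {linear V -> 'Hom(V, R^o)} :=
  HB.pack g2 (GRing.isLinear.Build _ _ _ _ g2 g2L).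
by rewrite -[RHS]/(g1 x y) -g2E; congr (fun_of_lfun _ y); exact: (lfunE g2F).
Qed.

(** For [l] above [ck_rank C], [inord l] defaults to 0. *)
Definition ck_lfun C (l : nat) := form_lfun (ck_quadric C (inord l)).

Lemma ck_vertexP C (i : 'I_(ck_rank C).+1) x :
  x \in ck_space C i.+1 <-> vertex (ck_quadric C i) x.
Proof. by rewrite ck_vertex. Qed.

Lemma ck_space_step C l :
  (l <= ck_rank C)%N -> (ck_space C l.+1 <= ck_space C l)%VS.
Proof.
rewrite -ltnS => lt_l; apply/subvP => x.
by move=> /(ck_vertexP (Ordinal lt_l))[y _ <-]; exact: subvsP.
Qed.

Lemma ck_lfun_sym C l x y : ck_lfun C l x y = ck_lfun C l y x.
Proof. by rewrite !form_lfunE hermC expr0 mul1r. Qed.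

Lemma ck_lfun_radical C l x : (l <= ck_rank C)%N -> x \in ck_space C l ->
  reflect (forall y, y \in ck_space C l -> ck_lfun C l x y = 0)
          (x \in ck_space C l.+1).
Proof.
(* This makes the indices of space and quadric the same ordinal. *)
move=> le_lr; have <- : (inord l : 'I_(ck_rank C).+1) = l :> nat by rewrite inordK.
rewrite /ck_lfun inord_val; move: (inord l) => i Ax.
have symf y : form_lfun (ck_quadric C i) x y = form_lfun (ck_quadric C i) y x.
  by rewrite !form_lfunE hermC expr0 mul1r.
apply: (iffP idP) => [/ck_vertexP[z z0 def_x] y Ay|x0].
  by rewrite symf form_lfunE -def_x vsvalK z0 // vsprojK.
apply/ck_vertexP; exists (vsproj _ x); last exact: vsprojK.
by move=> y Ay; rewrite -(x0 _ Ay) symf form_lfunE vsvalK.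
Qed.

Lemma polar_ck C (i : 'I_(ck_rank C).+1) x y : x \in ck_space C i ->
  polar (ck_quadric C i) <[x]>%VS y <->
  y \in ck_space C i /\ ck_lfun C i x y = 0.
Proof.
move=> Ax; rewrite /ck_lfun inord_val form_lfunE; split.
  case=> z z0 <-; rewrite vsvalK subvsP; split=> //.
  by apply: z0; rewrite vsprojK ?memv_line.
case=> Ay fxy0; exists (vsproj _ y); last exact: vsprojK.
move=> z /= /vlineP[k def_z]; rewrite -(vsvalK z) def_z linearZ linearZl_LR /=.
by rewrite fxy0 mulr0.
Qed.

Lemma point_total_polarP C (x : V) (phi : 'Hom(V, R^o)) : x != 0 -> phi != 0 ->
  point_total_polar C <[x]>%VS (lker phi) <->
  exists2 l, (l <= ck_rank C)%N &
    form_of_polar (ck_space C) (ck_lfun C) l (x, phi).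
Proof.
move=> nzx nzphi; split=> [[_ _ [i [Ax A'x sub]]]|[l le_lr [/= Ax A'x phi0]]].
  exists i; first by rewrite -ltnS.
  split=> //= y Ay fxy0; apply/eqP; rewrite -memv_ker; apply: sub.
  exact/polar_ck.
have lt_lr : (l < (ck_rank C).+1)%N by [].
split; first by rewrite /is_point dim_vline nzx.
  rewrite /is_hyperplane; have free_phi : free [:: phi] by rewrite seq1_free.
  have := dim_bigcap_ker free_phi; rewrite big_seq1 addn1 /dim /= mul1n.
  by case=> ->.
exists (Ordinal lt_lr); split=> // y /(@polar_ck _ (Ordinal lt_lr) _ _ Ax)[Ay fxy0].
by rewrite /= memv_ker phi0.
Qed.

Lemma total_polarP C K P :
  total_polar C K P <->
  exists ps, [/\ adapted (ck_rank C) (ck_space C) (ck_lfun C) K ps,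
                 free (unzip2 ps) &
                 P = (\bigcap_(phi <- unzip2 ps) lker phi)%VS].
Proof.
split=> [[_ [Xs [Hs []]]]|].
  move=> [xs free_xs defX] sXK cnt polar_ps [[phis free_phis defH] ->].
  have szx : size xs = \dim K by have := congr1 size defX; rewrite size_map size_tuple.
  have szp : size phis = \dim K.
    by have := congr1 size defH; rewrite size_map size_tuple.
  have eqsz : size xs = size phis by rewrite szx.
  exists (zip xs phis); rewrite /adapted unzip1_zip ?eqsz // unzip2_zip ?eqsz //.
  split=> //; last by rewrite -[RHS](big_map _ predT id) -defH big_tuple.
  (* These are [\dim K] independent vectors of [K]. *)
  have spanK : <<xs>>%VS = K.
    apply/eqP; rewrite eqEdim (eqP free_xs) szx leqnn andbT.
    apply/span_subvP => x xs_x; rewrite memvE.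
    have /tnthP[i ->] : <[x]>%VS \in Xs by rewrite memtE defX map_f.
    exact: sXK.
  split=> // [j /cnt <-|p /(nthP (0, 0))[i]].
    by rewrite defX count_map; apply: eq_count => x.
  rewrite size_zip -eqsz minnn => lt_i <-; rewrite nth_zip //.
  have lt_iK : (i < \dim K)%N by rewrite -szx.
  have := polar_ps (Ordinal lt_iK).
  rewrite !(tnth_nth 0%VS) defX defH !(nth_map 0) /= -?eqsz //.
  move/point_total_polarP; apply.
    by rewrite (free_not0 free_xs) ?mem_nth.
  by rewrite (free_not0 free_phis) ?mem_nth -?eqsz.
case=> ps [[free_xs spanK cnt polar_ps] free_phis ->].
have szK : size ps = \dim K by rewrite -spanK (eqP free_xs) size_map.
split.
  have := dim_bigcap_ker free_phis; rewrite /dim /= mul1n size_map szK => dimP.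
  by rewrite -[X in (X - _)%N]dimP addnK.
pose Xs := [seq <[x]>%VS | x <- unzip1 ps].
pose Hs := [seq lker phi | phi <- unzip2 ps].
have szX : size Xs == \dim K by rewrite !size_map szK.
have szH : size Hs == \dim K by rewrite !size_map szK.
exists (Tuple szX), (Tuple szH); split.
- by exists (unzip1 ps).
- move=> i; have /mapP[x ps_x ->] := mem_tnth i (Tuple szX).
  by rewrite -memvE -spanK memv_span.
- by move=> j /cnt <-; rewrite count_map; apply: eq_count => x.
- move=> i; rewrite !(tnth_nth 0%VS) /=.
  have lt_i : (i < size ps)%N by rewrite szK.
  rewrite !(nth_map 0) ?size_map //.
  have ps_p := mem_nth 0 lt_i; apply/point_total_polarP.
  + by rewrite (free_not0 free_xs) ?map_f.
  + by rewrite (free_not0 free_phis) ?map_f.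
  by case: (nth _ _ _) ps_p => x phi /polar_ps.
split; first by exists (unzip2 ps).
by rewrite -[LHS](big_map _ predT id) -/Hs -[Hs]/(tval (Tuple szH)) big_tuple.
Qed.

End CayleyKlein.

Theorem proposition3p12 (R : realType) (n : nat) (C : cayley_klein R n)
    (K K' : subspace R n) (sKK' : (K <= K')%VS) :
  (forall P : subspace R n, total_polar C K P ->
     exists P' : subspace R n, total_polar C K' P' /\ (P' <= P)%VS) /\
  (forall P' : subspace R n, total_polar C K' P' ->
     exists P : subspace R n, total_polar C K P /\ (P' <= P)%VS).
Proof.
have ker_anti (phis phis' : seq 'Hom('rV[R]_n.+1, R^o)) : (<<phis>> <= <<phis'>>)%VS ->
    (\bigcap_(phi <- phis') lker phi <= \bigcap_(phi <- phis) lker phi)%VS.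
  move=> /subvP sub; apply/subvP => v /memv_bigcap_ker v0.
  by apply/memv_bigcap_ker => phi /sub/v0.
have first := ck_space_first C; have last := ck_space_last C.
have step := @ck_space_step _ _ C; have radical := @ck_lfun_radical _ _ C.
have sym l x y : (l <= ck_rank C)%N -> x \in ck_space C l -> y \in ck_space C l ->
    ck_lfun C l x y = ck_lfun C l y x by move=> *; apply: ck_lfun_sym.
(* Passing to common kernels reverses inclusions: shrinking [P] means adding forms, and enlarging
   [P'] means dropping forms. *)
split=> [P|P'] /total_polarP[ps [ad_ps free_ps ->]].
  have [ps' [ad' free' sub]] :=
    adapted_extend first last step sym radical sKK' ad_ps free_ps.
  exists (\bigcap_(phi <- unzip2 ps') lker phi)%VS; split; last exact: ker_anti.
  by apply/total_polarP; exists ps'.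
have [ps' [ad' free' sub]] :=
  adapted_restrict first last step sym radical sKK' ad_ps free_ps.
exists (\bigcap_(phi <- unzip2 ps') lker phi)%VS; split; last exact: ker_anti.
by apply/total_polarP; exists ps'.
Qed.
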